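(* Let $n\ge 2$ be an integer and let $N$ be an integer with $N \ge \frac74 n+10$. Then $P_N^3\to(\mathcal{C}_{\le 5},P_n)$; that is, for every red/blue coloring of the edges of $P_N^3$ with no red cycle of length $3$, $4$ or $5$, there is a blue path on at least $n$ vertices.
   Context: $P_N$ denotes the path on $N$ vertices and $P_N^3$ its third power: the graph on vertex set $[N]=\{1,\dots,N\}$ in which $i$ and $j$ are adjacent iff $1\le |i-j|\le 3$. For a family of graphs $\mathcal{F}$ and a graph $H$, $G\to(\mathcal{F},H)$ means every red/blue coloring of $E(G)$ contains a red copy of some member of $\mathcal{F}$ or a blue copy of $H$. $\mathcal{C}_{\le m}$ denotes the family of all cycles of length at most $m$. *)

(* Defs.v *)
From mathcomp Require Import all_boot.
Set Implicit Arguments. Unset Strict Implicit. Unset Printing Implicit Defensive.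

Definition inV (N : nat) (v : nat) : bool := (1 <= v <= N).

Definition p3adj (N : nat) (i j : nat) : bool :=
  [&& inV N i, inV N j, i != j & maxn i j - minn i j <= 3].

(* A red/blue colouring of the edges: an arbitrary function on ordered pairs,
   read only on the normalised pair (min, max), so it is a colouring of
   unordered edges.  [true] = red, [false] = blue. *)
Definition coloring := nat -> nat -> bool.
Definition is_red (c : coloring) (i j : nat) : bool := c (minn i j) (maxn i j).

Definition red_edge (N : nat) (c : coloring) (i j : nat) : bool :=
  p3adj N i j && is_red c i j.
Definition blue_edge (N : nat) (c : coloring) (i j : nat) : bool :=
  p3adj N i j && ~~ is_red c i j.

Definition red_cycle (N : nat) (c : coloring) (k : nat) (s : seq nat) : Prop :=
  [/\ size s = k, 3 <= k, uniq s, all (inV N) s & cycle (red_edge N c) s].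

Definition blue_path (N : nat) (c : coloring) (s : seq nat) : Prop :=
  [/\ uniq s, all (inV N) s & sorted (blue_edge N c) s].

(* Main.v *)
Require Import Defs.
From mathcomp Require Import all_boot.
From mathcomp Require Import zify.

(** Call a vertex open if some edge from it to a larger vertex is blue.  Let a
    blue path end at an open vertex [i], all its other vertices being smaller.
    A search over the colourings of the edges on the twelve vertices
    [i, ..., i + 11] shows that the path extends to an open [j > i], using only
    vertices of [i + 1, ..., j] and at least [4 (j - i) / 7] of them.  One of the
    vertices [1], [2] is open (if [1] is not, then [2 3] is blue, as [1 2 3] is
    not a red triangle), and iterating from it, as long as the path ends before
    [N - 10], gives the path. *)

Definition nbrs (A : seq (nat * nat)) (x : nat) : seq nat :=
  [seq e.2 | e <- A & e.1 == x] ++ [seq e.1 | e <- A & e.2 == x].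

(* The path [s] is stored with its growing end first. *)
Fixpoint extendable (A : seq (nat * nat)) (ok : pred (seq nat)) (m n : nat)
    (s : seq nat) : bool :=
  ok s || (if n is n'.+1 then
    has (fun z => [&& z <= m, z \notin s & extendable A ok m n' (z :: s)])
      (nbrs A (head 0 s))
  else false).

(** Tested before [(x, y)] joins [R]: with fuel [4] the red path from [x] to [y] has three to five
    vertices, and the new edge closes it. The bound [y] loses nothing, as [window] lists edges by
    larger end. *)
Definition closes_cycle (R : seq (nat * nat)) (x y : nat) : bool :=
  extendable R (fun s => (head 0 s == y) && (2 < size s)) y 4 [:: x].

(** These three red edges would leave vertex [0] not open. *)
Definition claw (R : seq (nat * nat)) : bool :=
  all (mem R) [:: (0, 1); (0, 2); (0, 3)].

(** The predecessor discards vertex [0], which already lies on the path being extended. *)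
Definition reaches (B : seq (nat * nat)) (j : nat) : bool :=
  (0 < j) && extendable B
    (fun s => (head 0 s == j) && (4 * j <= 7 * (size s).-1)) j j [:: 0].

(* Colours the edges of [E] one by one, [R] and [B] being the edges coloured
   red and blue so far. *)
Fixpoint search (E R B : seq (nat * nat)) : bool :=
  if E is (x, y) :: E' then
    [|| closes_cycle R x y, claw ((x, y) :: R) | search E' ((x, y) :: R) B] &&
    (reaches B x || search E' R ((x, y) :: B))
  else false.

(* The order matters: when the edge [(x, y)] is coloured, all edges inside
   [0, ..., x] have been. *)
Definition window : seq (nat * nat) :=
  [seq (x, y) | y <- iota 1 11, x <- iota (y - 3) (minn y 3)].

Lemma window_search : search window [::] [::].
Proof. by lazy. Qed.

Lemma mem_window x y : (x, y) \in window -> [/\ x < y, y <= x + 3 & y <= 11].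
Proof.
by case/allpairsPdep => [v [u []]]; rewrite !mem_iota => hv hu [-> ->]; split; lia.
Qed.

Lemma nbrsP (A : seq (nat * nat)) (e : rel nat) x z :
  symmetric e -> (forall p, p \in A -> e p.1 p.2) -> z \in nbrs A x -> e z x.
Proof.
move=> esym eA; rewrite mem_cat => /orP[] /mapP[p];
  by rewrite mem_filter => /andP[/eqP <- /eA pe] ->; rewrite // esym.
Qed.

Lemma extendableP (A : seq (nat * nat)) (e : rel nat) ok m n s :
    symmetric e -> (forall p, p \in A -> e p.1 p.2) -> s != [::] ->
    uniq s -> sorted e s -> extendable A ok m n s ->
  exists t, [/\ ok (t ++ s), uniq (t ++ s), sorted e (t ++ s), size t <= n
              & all (leq^~ m) t].
Proof.
move=> esym eA; elim: n s => [|n IHn] s s0 us ss /=.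
  by rewrite orbF => oks; exists [::].
case/orP=> [oks|/hasP[z zA /and3P[zm zs]]]; first by exists [::].
have sz : sorted e (z :: s).
  by case: s s0 ss zA {us zs} => //= x s _ -> /(nbrsP _ _ _ _ esym eA) ->.
case/IHn; rewrite //= ?zs // => t [okt ut st tn tm].
exists (rcons t z); rewrite cat_rcons size_rcons; split=> //.
by rewrite all_rcons zm.
Qed.

(** The given colouring follows one branch, which must stop early because running out of edges
    counts as failure. A stop at a red edge contradicts the hypotheses on [red]; a stop at a blue
    edge [(x, y)] comes with a path to [x], and this edge makes [x] open. *)
Lemma search_sound (red blue : rel nat) E R B :
    symmetric red -> symmetric blue ->
    (forall s, 2 < size s <= 5 -> uniq s -> ~~ cycle red s) ->
    ~~ [&& red 0 1, red 0 2 & red 0 3] ->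
    (forall x y, (x, y) \in E -> red x y || blue x y) ->
    (forall p, p \in R -> red p.1 p.2) -> (forall p, p \in B -> blue p.1 p.2) ->
    search E R B ->
  exists x y t, [/\ (x, y) \in E, blue x y, 0 < x,
    [/\ uniq (rcons t 0), sorted blue (rcons t 0), head 0 t = x
      & all (leq^~ x) t] & 4 * x <= 7 * size t].
Proof.
move=> rsym bsym nocyc noclaw.
elim: E R B => [//|[x y] E IHE] R B col rR bB /= /andP[].
have colE u v : (u, v) \in E -> red u v || blue u v.
  by move=> uv; apply: col; rewrite inE uv orbT.
have widen : (exists u v t, [/\ (u, v) \in E, blue u v, 0 < u,
    [/\ uniq (rcons t 0), sorted blue (rcons t 0), head 0 t = u
      & all (leq^~ u) t] & 4 * u <= 7 * size t]) ->
  exists u v t, [/\ (u, v) \in (x, y) :: E, blue u v, 0 < u,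
    [/\ uniq (rcons t 0), sorted blue (rcons t 0), head 0 t = u
      & all (leq^~ u) t] & 4 * u <= 7 * size t].
  move=> [u [v [t [uv ? ? ? ?]]]]; exists u, v, t; split=> //.
  by rewrite inE uv orbT.
have := col x y (mem_head _ _).
case/orP=> exy.
  have rR' p : p \in (x, y) :: R -> red p.1 p.2.
    by rewrite inE => /predU1P[-> //|/rR].
  case/or3P=> [||sE _]; last by apply: widen; exact: IHE sE.
    case/(extendableP _ _ _ _ _ _ rsym rR)=> // t.
    case=> /andP[/eqP hy sz] ut st tn _.
    have sz5 : 2 < size (t ++ [:: x]) <= 5.
      by rewrite sz size_cat addn1 ltnS.
    suff cyc : cycle red (t ++ [:: x]) by have := nocyc _ sz5 ut; rewrite cyc.
    case: t hy sz ut st {tn sz5} => [|z t] //= -> _ _.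
    by rewrite !cats1 => st; rewrite rcons_path last_rcons st.
  rewrite /claw /= => /and4P[r1 r2 r3 _] _; case/negP: noclaw.
  by apply/and3P; split; [exact: rR' r1|exact: rR' r2|exact: rR' r3].
move=> _ /orP[/andP[x0]|sE]; last first.
  apply: widen; apply: IHE sE => // p.
  by rewrite inE => /predU1P[-> //|/bB].
case/(extendableP _ _ _ _ _ _ bsym bB)=> // t.
rewrite cats1 size_rcons => -[/andP[/eqP hx sz] ut st _ tx].
exists x, y, t; split=> //; first exact: mem_head.
(* The default [0] of [head] is the dropped end of the path, so an empty [t] is harmless. *)
split=> //; case: t hx {sz ut st tx} => //= hx.
Qed.

Definition opened (N : nat) (c : coloring) (i : nat) : Prop :=
  exists2 k, i < k & blue_edge N c i k.

Lemma p3adj_sym N : symmetric (p3adj N).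
Proof. by move=> x y; rewrite /p3adj eq_sym maxnC minnC andbCA. Qed.

Lemma is_red_sym c : symmetric (is_red c).
Proof. by move=> x y; rewrite /is_red maxnC minnC. Qed.

Lemma red_edge_sym N c : symmetric (red_edge N c).
Proof. by move=> x y; rewrite /red_edge p3adj_sym is_red_sym. Qed.

Lemma blue_edge_sym N c : symmetric (blue_edge N c).
Proof. by move=> x y; rewrite /blue_edge p3adj_sym is_red_sym. Qed.

Lemma p3adj_lt N x y : 0 < x -> x < y -> y <= x + 3 -> y <= N -> p3adj N x y.
Proof. by move=> *; rewrite /p3adj /inV; lia. Qed.

Lemma edge_colored N c x y :
  0 < x -> x < y -> y <= x + 3 -> y <= N -> red_edge N c x y || blue_edge N c x y.
Proof.
by move=> *; rewrite /red_edge /blue_edge p3adj_lt //= orbN.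
Qed.

Lemma red_edge_not_blue N c x y : red_edge N c x y -> ~~ blue_edge N c x y.
Proof. by rewrite /red_edge /blue_edge => /andP[-> ->]. Qed.

Lemma no_short_red_cycle N c :
    (forall (k : nat) (s : seq nat), 3 <= k <= 5 -> ~ red_cycle N c k s) ->
  forall s, 2 < size s <= 5 -> uniq s -> ~~ cycle (red_edge N c) s.
Proof.
move=> nocyc s sz us; apply/negP => cs; apply: (nocyc (size s) s sz).
split=> //; first by case/andP: sz.
apply/allP=> x xs; have := next_cycle cs xs.
by case/andP; case/and4P.
Qed.

Lemma opened_not_claw N c i : opened N c i ->
  ~~ [&& red_edge N c i (i + 1), red_edge N c i (i + 2) & red_edge N c i (i + 3)].
Proof.
case=> k ik bk; apply/negP => /and3P[r1 r2 r3].
have : [|| k == i + 1, k == i + 2 | k == i + 3].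
  by case/andP: bk => /and4P[]; rewrite /inV; lia.
by case/or3P=> /eqP ek; move: bk; apply/negP; rewrite ek red_edge_not_blue.
Qed.

Lemma opened_extend N c i :
    (forall (k : nat) (s : seq nat), 3 <= k <= 5 -> ~ red_cycle N c k s) ->
    0 < i -> i + 11 <= N -> opened N c i ->
  exists j t, [/\ i < j, opened N c j, 4 * (j - i) <= 7 * size t
    & [/\ uniq t, sorted (blue_edge N c) (rcons t i), head i t = j
        & all (fun v => i < v <= j) t]].
Proof.
move=> nocyc i0 iN oi.
(* Vertex [x] of the window stands for [i + x]. *)
pose shift (e : rel nat) : rel nat := fun x y => e (i + x) (i + y).
have shsym e : symmetric e -> symmetric (shift e) by move=> es x y; apply: es.
have := window_search.
case/(search_sound (shift (red_edge N c)) (shift (blue_edge N c))).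
- exact/shsym/red_edge_sym.
- exact/shsym/blue_edge_sym.
- move=> s sz us; have := no_short_red_cycle _ _ nocyc [seq i + x | x <- s].
  by rewrite size_map map_inj_uniq ?cycle_map; [apply|exact: addnI].
- by rewrite /shift addn0; exact: opened_not_claw.
- move=> x y /mem_window[xy y3 y11].
  by apply: edge_colored; lia.
- by [].
- by [].
move=> x [y [t [xy bxy x0 [ut st hx tx] sz]]].
have [ltxy _ _] := mem_window _ _ xy.
exists (i + x), [seq i + v | v <- t]; split.
- by rewrite -[X in X < _]addn0 ltn_add2l.
- by exists (i + y); rewrite ?ltn_add2l.
- by rewrite size_map addKn.
move: ut; rewrite rcons_uniq => /andP[t0 ut]; split.
- by rewrite map_inj_uniq //; exact: addnI.
- by rewrite -{2}[i]addn0 -map_rcons sorted_map.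
- by case: t hx {sz st tx t0 ut} => /= [|v t ->] //; lia.
(* The path does not repeat its end [0], so [0] is not in [t] and the lower bound is strict. *)
apply/allP=> _ /mapP[v vt ->]; have := allP tx v vt.
by case: v vt => [vt|v _]; [rewrite vt in t0|lia].
Qed.

Lemma opened_start N c :
    (forall (k : nat) (s : seq nat), 3 <= k <= 5 -> ~ red_cycle N c k s) ->
    2 < N ->
  exists2 i, 0 < i <= 2 & opened N c i.
Proof.
move=> nocyc N3.
have /orP[r12|b12] := @edge_colored N c 1 2 isT isT isT (ltnW N3); last first.
  by exists 1 => //; exists 2.
have /orP[r13|b13] := @edge_colored N c 1 3 isT isT isT N3; last first.
  by exists 1 => //; exists 3.
have /orP[r23|b23] := @edge_colored N c 2 3 isT isT isT N3; last first.
  by exists 2 => //; exists 3.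
have := no_short_red_cycle _ _ nocyc [:: 1; 2; 3] isT isT.
by rewrite /= r12 r23 red_edge_sym r13.
Qed.

(** The [+ 1] is for the start: [i = 2] with one vertex gives [8 = 7 + 1]. Extensions preserve it,
    as [4 * (j - i) <= 7 * size t]. *)
Lemma long_blue_path N c :
    (forall (k : nat) (s : seq nat), 3 <= k <= 5 -> ~ red_cycle N c k s) ->
    2 < N ->
  forall m, m + 10 <= N ->
  exists i s, [/\ m <= i, opened N c i, 4 * i <= 7 * size s + 1,
    path (blue_edge N c) i (behead s) & [/\ uniq s, head 0 s = i, 0 < i
    & all (fun v => 0 < v <= i) s]].
Proof.
move=> nocyc N3; elim=> [|m IHm] mN.
  have [i /andP[i0 i2] oi] := opened_start N c nocyc N3.
  by exists i, [:: i]; split=> //=; [lia|rewrite i0 leqnn; split].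
case: IHm => [|i [s [mi oi sz ps [us hs i0 sa]]]]; first by lia.
(* Otherwise [i <= m], so [i + 11 <= N] and the window fits. *)
have [ltmi|leim] := ltnP m i; first by exists i, s.
have [j [t [ij oj szt [ut st hj ta]]]] : exists j t, [/\ i < j, opened N c j,
    4 * (j - i) <= 7 * size t & [/\ uniq t, sorted (blue_edge N c) (rcons t i),
    head i t = j & all (fun v => i < v <= j) t]].
  by apply: opened_extend; rewrite //; lia.
case: s hs us sa sz ps => [/= ei|i' s ei us sa sz ps]; first by rewrite -ei in i0.
rewrite /= in ei ps; rewrite {i'}ei in us sa sz.
case: t hj ut st ta szt => [/= ej|j' t ej ut st ta szt].
  by rewrite ej ltnn in ij.
rewrite /= in ej; rewrite {j'}ej in ut st ta szt.
exists j, ((j :: t) ++ i :: s); split=> //; first by lia.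
- by rewrite size_cat /= in sz szt *; lia.
- by move: st; rewrite /= -cat_rcons cat_path last_rcons => ->.
split=> //; last 2 first.
- by lia.
- rewrite all_cat; apply/andP; split; apply/allP => v.
    by move/(allP ta); lia.
  by move/(allP sa); lia.
rewrite cat_uniq ut us andbT; apply/hasPn => v /(allP sa) vi.
by apply/negP => /(allP ta); lia.
Qed.

Theorem theorem1p1 (n N : nat) :
  2 <= n -> 7 * n + 40 <= 4 * N ->
  forall c : coloring,
    (forall (k : nat) (s : seq nat), 3 <= k <= 5 -> ~ red_cycle N c k s) ->
    exists s : seq nat, blue_path N c s /\ n <= size s.
Proof.
move=> n2 nN c nocyc.
(* From [N - 10 <= i] follows [7 * n <= 4 * i <= 7 * size s + 1]; integrality absorbs the [1]. *)
have [||i [s [mi oi sz ps [us hs i0 sa]]]] :=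
  @long_blue_path N c nocyc _ (N - 10) _; try lia.
have iN : i <= N by case: oi => k _ /andP[/and4P[/andP[]]].
exists s; split; last by lia.
split=> //; last by case: s hs ps {us sa sz} => //= v s ->.
by apply/allP => v /(allP sa) /andP[v0 vi]; rewrite /inV v0 (leq_trans vi).
Qed.
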